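(* In dimension $3$, $\gamma(C_3^*,r)\geq 13$ for every $r\in\left(\frac12,\frac6{11}\right]$.
   Context: $C_3^*=\{\mathbf{x}\in\mathbb{R}^3 : |x_1|+|x_2|+|x_3|\leq 1\}$ is the unit cross-polytope and $\|\cdot\|_1$ is the $l_1$-norm on $\mathbb{R}^3$. For $r>0$, $\gamma(C_3^*,r):=\max\{|D| : D\subset C_3^*\text{ and }\|\mathbf{x}-\mathbf{y}\|_1\geq 2r\text{ for all }\mathbf{x},\mathbf{y}\in D,\ \mathbf{x}\neq\mathbf{y}\}$, where $|D|$ denotes the cardinality of $D$. *)

(* Defs.v *)
From HB Require Import structures.
From mathcomp Require Import all_boot all_order all_algebra.
From mathcomp Require Import boolp classical_sets functions cardinality reals.

Set Implicit Arguments.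
Unset Strict Implicit.
Unset Printing Implicit Defensive.

Import Order.TTheory GRing.Theory Num.Theory.
Local Open Scope classical_set_scope.
Local Open Scope card_scope.
Local Open Scope ring_scope.

(* Mathcomp-Analysis equips ['rV[R]_n] with the sup norm, hence [l1norm]. *)
Definition l1norm (R : realType) (n : nat) (x : 'rV[R]_n) : R :=
  \sum_(i < n) `|x 0 i|.

Definition crosspolytope (R : realType) (n : nat) : set 'rV[R]_n :=
  [set x | l1norm x <= 1].
Arguments crosspolytope : clear implicits.

Definition separated (R : realType) (n : nat) (C : set 'rV[R]_n) (r : R)
    (D : set 'rV[R]_n) : Prop :=
  D `<=` C /\
  forall x y, D x -> D y -> x <> y -> 2 * r <= l1norm (x - y).

(* [D] ranges over arbitrary sets: the second conjunct also says that no
   infinite separated subset exists. *)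
Definition is_max_separated (R : realType) (n : nat) (C : set 'rV[R]_n) (r : R)
    (m : nat) : Prop :=
  (exists2 D, separated C r D & D #= `I_m) /\
  (forall D, separated C r D -> D #<= `I_m).

(* The maximum is unique when it exists; the default value 0 is used otherwise,
   so a positive lower bound on [gamma C r] entails that it exists. *)
Definition gamma (R : realType) (n : nat) (C : set 'rV[R]_n) (r : R) : nat :=
  xget 0%N (is_max_separated C r).

(* Main.v *)
(* Thirteen integer points of l1-norm at most 11 and mutual l1-distance at least
   12, scaled by 1/11, form a separated set for every r <= 6/11. Since gamma is
   0 when the maximum does not exist, separated sets must also be bounded: a
   grid of mesh 1/k with n/k < 2r has finitely many cells meeting the
   cross-polytope, and each cell holds at most one point of a separated set. *)
Require Import Defs.
From mathcomp Require Import all_boot all_order all_algebra.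
From mathcomp Require Import boolp classical_sets functions cardinality reals.
From mathcomp Require Import lra.

Import Order.TTheory GRing.Theory Num.Theory.
Local Open Scope ring_scope.

Lemma l1normBC (R : realType) (n : nat) (x y : 'rV[R]_n) :
  l1norm (x - y) = l1norm (y - x).
Proof. by apply: eq_bigr => i _; rewrite !mxE distrC. Qed.

Lemma separated_crosspolytope_bounded (R : realType) (n : nat) (r : R) :
  0 < r ->
  exists N, forall D, separated (crosspolytope R n) r D -> (D #<= `I_N)%card.
Proof.
move=> r0; pose k := (Num.truncn (n%:R / (2 * r))).+1.
have k0 : 0 < k%:R :> R by rewrite ltr0n.
have nk : n%:R / k%:R < 2 * r.
  rewrite ltr_pdivrMr// mulrC -ltr_pdivrMr; last lra.
  have /truncn_itv/andP[_] : 0 <= n%:R / (2 * r) by rewrite divr_ge0//; lra.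
  by [].
(* On the cross-polytope [k * (x 0 i + 1)] lies in [[0, 2k]]. The endpoint [2k] is attained at
   [x 0 i = 1], hence [2k + 1] indices per axis, and [inord] never falls back on its default
   there. *)
pose cell (x : 'rV[R]_n) : {ffun 'I_n -> 'I_(2 * k).+1} :=
  [ffun i => inord (Num.truncn (k%:R * (x 0 i + 1)))].
exists #|{: {ffun 'I_n -> 'I_(2 * k).+1}}| => D [DC Dsep].
have coord x i : D x -> `|x 0 i| <= 1.
  move=> /DC; apply: le_trans; rewrite /l1norm (bigD1 i)//= lerDl.
  exact: sumr_ge0.
have cellP x i : D x ->
    (cell x i)%:R <= k%:R * (x 0 i + 1) < (cell x i)%:R + 1.
  move=> /(coord x i); rewrite ler_norml => /andP[xge xle].
  have y0 : 0 <= k%:R * (x 0 i + 1) by rewrite mulr_ge0 ?ler0n//; lra.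
  rewrite ffunE inordK; first by rewrite natr1; exact: truncn_itv.
  rewrite ltnS -(ler_nat R); have /truncn_itv/andP[/le_trans + _] := y0; apply.
  by rewrite natrM mulrC ler_wpM2r//; lra.
(* [enum_rank] numbers the cells, so that the image of [D] lies in an ordinal type of known
   cardinality. *)
have cell_inj : {in D &, injective (enum_rank \o cell)}.
  move=> x y /set_mem Dx /set_mem Dy /enum_rank_inj xy.
  apply: contrapT => /(Dsep x y Dx Dy); apply/negP; rewrite -ltNge.
  (* Coordinates of points in a common cell differ by at most [1/k], so the distance is at most
     [n/k]. Strictness comes from [nk] alone, which also covers [n = 0]. *)
  apply: le_lt_trans nk; rewrite /l1norm.
  rewrite -[n in n%:R]card_ord -sumr_const mulr_suml.
  apply: ler_sum => i _; rewrite !mxE ler_pdivlMr// -[X in _ * X]ger0_norm//.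
  rewrite -normrM; have := cellP x i Dx; have := cellP y i Dy; rewrite xy.
  move: (cell y i)%:R => c; rewrite ler_norml => /andP[? ?] /andP[? ?].
  by apply/andP; split; nra.
rewrite -(card_le_eql (inj_card_eq cell_inj)) (card_le_eqr card_II).
exact: card_leT.
Qed.

(** The uniform bound makes every separated set finite, and the sizes that occur form a nonempty
    bounded set of naturals. Its largest element satisfies [is_max_separated], so [xget] does not
    return its default. *)
Lemma leq_gamma (R : realType) (n : nat) (C : set 'rV[R]_n) (r : R)
    (D : set 'rV[R]_n) (m : nat) :
    (exists N, forall E, separated C r E -> (E #<= `I_N)%card) ->
  separated C r D -> (`I_m #<= D)%card -> (m <= gamma C r)%N.
Proof.
move=> [N bndN] sepD mD.
pose P k := `[< exists2 E, separated C r E & (E #= `I_k)%card >].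
have finP E : separated C r E -> exists k, (E #= `I_k)%card.
  by move=> /bndN EN; apply/finite_setP/finite_set_leP; exists N.
have exP : exists k, P k.
  by have [k Dk] := finP D sepD; exists k; apply/asboolP; exists D.
have ubP k : P k -> (k <= N)%N.
  move=> /asboolP[E /bndN EN /card_esym kE].
  by rewrite -card_le_II (card_le_eql kE).
have [M /asboolP PM maxM] := ex_maxnP exP ubP.
have maxC E : separated C r E -> (E #<= `I_M)%card.
  move=> sepE; have [k Ek] := finP E sepE.
  by rewrite (card_le_eql Ek) card_le_II; apply/maxM/asboolP; exists E.
have [_ gmax] : is_max_separated C r (gamma C r) by apply: xgetPex; exists M.
by rewrite -card_le_II; exact: card_le_trans mD (gmax D sepD).
Qed.

(* Found by computer search. *)
Definition code : seq (seq int) :=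
  [:: [:: -11; 0; 0]; [:: -5; -4; 2]; [:: -1; -2; 8]; [:: 4; 2; 5];
      [:: -3; 5; 3]; [:: -5; 2; -4]; [:: 5; -5; 1]; [:: 0; -11; 0];
      [:: 5; 1; -5]; [:: 11; 0; 0]; [:: 3; 7; -1]; [:: 0; 0; -11];
      [:: -1; -5; -5]].

Definition dist1 (u v : seq int) : int :=
  `|u`_0 - v`_0| + `|u`_1 - v`_1| + `|u`_2 - v`_2|.

(* [[::]] stands for the origin, its missing coordinates being read as 0. *)
Lemma code_norm : all (fun u => dist1 u [::] <= 11) code.
Proof. by vm_compute. Qed.

Lemma code_dist : pairwise (fun u v => 12 <= dist1 u v) code.
Proof. by vm_compute. Qed.

Definition point (R : realType) (u : seq int) : 'rV[R]_3 :=
  \row_i ((u`_i)%:~R / 11).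

Lemma l1norm_pointB (R : realType) (u v : seq int) :
  l1norm (point R u - point R v) = (dist1 u v)%:~R / 11.
Proof.
rewrite /l1norm /dist1 !big_ord_recr big_ord0 /= add0r !rmorphD !mulrDl /=.
by rewrite !mxE -!mulrBl !normrM -!intrB !intr_norm
  (@ger0_norm _ 11^-1) ?invr_ge0 ?ler0n.
Qed.

Lemma point_nil (R : realType) : point R [::] = 0.
Proof. by apply/rowP => i; rewrite !mxE nth_nil mul0r. Qed.

Theorem proposition1p3 (R : realType) (r : R) (hr1 : 1 / 2 < r)
    (hr2 : r <= 6 / 11) :
  (13 <= gamma (crosspolytope R 3) r)%N.
Proof.
pose x i := point R (nth [::] code i).
have dist_x i j : (i < 13)%N -> (j < 13)%N -> i != j ->
    2 * r <= l1norm (x i - x j).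
  (* [pairwise] only compares entries in list order; symmetry of the distance gives the other
     order. *)
  wlog ij : i j / (i < j)%N.
    move=> H i13 j13; rewrite neq_ltn => /orP[] ij.
      by apply: H => //; rewrite ltn_eqF.
    by rewrite l1normBC; apply: H => //; rewrite ltn_eqF.
  move=> i13 j13 _; rewrite l1norm_pointB.
  have /(pairwiseP [::])/(_ i j i13 j13 ij) := code_dist.
  by rewrite -(ler_int R) => d12; lra.
apply: (@leq_gamma _ _ _ _ [set x i | i in `I_13]%classic).
- by apply: separated_crosspolytope_bounded; lra.
- split=> [_ [i i13 <-]|_ _ [i i13 <-] [j j13 <-] xij].
    (* The norm is read as the distance to the origin, [point R [::]], to match [code_norm]. *)
    rewrite /crosspolytope/= -[x i]subr0 -point_nil l1norm_pointB.
    have /(all_nthP [::])/(_ i i13) := code_norm.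
    by rewrite -(ler_int R) => n11; lra.
  by apply: dist_x => //; apply: contra_notN xij => /eqP ->.
- suff xinj : {in `I_13 &, injective x}.
    by rewrite (card_le_eqr (inj_card_eq xinj)).
  (* Equal points with distinct indices would be at distance 0, yet at least [2 * r > 0] apart. *)
  move=> i j /set_mem i13 /set_mem j13 xij; apply: contraTeq isT => nij.
  have := dist_x i j i13 j13 nij.
  by rewrite xij subrr /l1norm big1 => [|k _]; rewrite ?mxE ?normr0//; lra.
Qed.
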